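(* Let $F$ be a field of characteristic $p>0$ and let $G$ be a finite basic group (with respect to $p$) such that $\operatorname{soc}(ZFG)$ is an ideal in $FG$. Write $G=G'\rtimes H$ with $H$ an abelian Hall $p'$-subgroup of $G$, and set $D:=G/G''$ and $Z_D:=Z(G')/G''$. Then the group $D$ has the following properties: (i) $D'=T\times Z_D$ for an elementary abelian normal subgroup $T$ of $D$. (ii) Write $T=T_1\times\dots\times T_n$ with minimal normal subgroups $T_1,\dots,T_n$ of $D$. Then $$H/C_H(T)\cong H/C_H(T_1)\times\dots\times H/C_H(T_n),$$ where, for every $i\in\{1,\dots,n\}$, the group $H/C_H(T_i)$ is cyclic of order $|T_i|-1$.
   Context: For a finite group $X$, $X'$ is the derived subgroup, $X''=(X')'$, $Z(X)$ the center, $O_{p'}(X)$ the largest normal subgroup of order prime to $p$. $FG$ is the group algebra, $ZFG$ its center, and $\operatorname{soc}(ZFG)$ the socle of the ring $ZFG$ (sum of its minimal ideals). ''Ideal in $FG$'' means two-sided ideal. A finite group $G$ is called basic (with respect to the prime $p$) if $G'$ is a Sylow $p$-subgroup of $G$ and $O_{p'}(G)=1$; then $G=G'\rtimes H$ for an abelian Hall $p'$-subgroup $H$. It is known that under the hypotheses $G''\subseteq\Phi(G')\subseteq Z(G')$ (with $\Phi$ the Frattini subgroup), so $Z_D$ is defined. The group $H$ is identified with its image in $D$, so that $D= D'\rtimes H$; $C_H(T)$ and $C_H(T_i)$ are the centralizers in $H$ with respect to the conjugation action in $D$. The number $n$ is a nonnegative integer ($n=0$ if and only if $T=1$). *)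

(* Defs.v *)
From Stdlib Require Import Classical ClassicalEpsilon.
From mathcomp Require Import all_boot all_order all_fingroup all_algebra.
From mathcomp Require Import all_solvable all_character.

Set Implicit Arguments.
Unset Strict Implicit.
Unset Printing Implicit Defensive.

Import GroupScope GRing.Theory.

(* Subalgebras of 'M_n, and ideals in them, are encoded by row spaces of mxvec  *)
(* encodings, as in mxalgebra. Ideals of a unital algebra are linear subspaces, *)
(* so ring ideals and algebra ideals coincide in 'R_G = group_ring F G and in   *)
(* 'Z('R_G). The library's mx_ideal R S does not require S to be contained in   *)
(* R.                                                                           *)
Section Ideals.

Variables (F : fieldType) (n : nat).

Definition alg_ideal m1 m2 (R : 'A[F]_(m1, n)) (S : 'A[F]_(m2, n)) : bool :=
  (S <= R)%MS && mx_ideal R S.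

Definition min_alg_ideal m (R : 'A[F]_(m, n)) (S : 'A[F]_n) : Prop :=
  [/\ alg_ideal R S, S != 0%R &
      forall U : 'A[F]_n, alg_ideal R U -> U != 0%R -> (U <= S)%MS ->
        (S <= U)%MS].

(* A finite sum of minimal ideals containing every minimal ideal, i.e. the sum  *)
(* of all the minimal ideals.                                                   *)
Definition is_alg_socle m (R : 'A[F]_(m, n)) (S : 'A[F]_n) : Prop :=
  (exists2 s : seq 'A[F]_n,
     forall I, I \in s -> min_alg_ideal R I & S = (\sum_(I <- s) I)%MS)
  /\ (forall I, min_alg_ideal R I -> (I <= S)%MS).

Lemma is_alg_socle_ex m (R : 'A[F]_(m, n)) : exists S, is_alg_socle R S.
Proof.
suff ext k (s : seq 'A[F]_n) : (forall I, I \in s -> min_alg_ideal R I) ->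
    n ^ 2 - \rank (\sum_(I <- s) I)%MS <= k -> exists S, is_alg_socle R S.
  exact: (ext _ [::]) (leqnn _).
elim: k s => [|k IHk] s min_s le_k;
  set S := (\sum_(I <- s) I)%MS in le_k;
  case: (classic (forall I, min_alg_ideal R I -> (I <= S)%MS)) => [maxS|nmaxS];
  try by exists S; split=> //; exists s.
  case: nmaxS => I _; apply: submx_full.
  by rewrite /row_full eqn_leq rank_leq_col -subn_eq0 -leqn0.
have [I nI] := not_all_ex_not _ _ nmaxS.
have [minI /negP nIS] := imply_to_and _ _ nI.
apply: (IHk (I :: s)) => [J|].
  by rewrite inE => /predU1P[-> //|/min_s].
rewrite big_cons -/S.
have ltS : \rank S < \rank (I + S)%MS.
  rewrite (ltn_leqif (mxrank_leqif_sup (addsmxSr I S))).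
  by apply: contra nIS; apply: submx_trans (addsmxSl I S).
rewrite -ltnS; apply: leq_trans le_k; apply: ltn_sub2l => //.
exact: leq_trans ltS (rank_leq_col _).
Qed.

Definition alg_socle m (R : 'A[F]_(m, n)) : 'A[F]_n :=
  epsilon (inhabits 0%R) (is_alg_socle R).

Lemma alg_socleP m (R : 'A[F]_(m, n)) : is_alg_socle R (alg_socle R).
Proof. exact: epsilon_spec (is_alg_socle_ex R). Qed.

End Ideals.

Definition basic_group (p : nat) (gT : finGroupType) (G : {group gT}) : bool :=
  p.-Sylow(G) G^`(1) && ('O_p^'(G) == 1).

(* Main.v *)
Require Import Defs.
From mathcomp Require Import all_boot all_order all_fingroup all_algebra.
From mathcomp Require Import all_solvable all_character.

(** Write P for the derived subgroup G', Z for its center and V for P / Z.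

    The socle enters through one observation.  If a central element z of FG is
    multiplied by every class sum as by a scalar, namely its augmentation, then
    the line F z is a one-dimensional, hence minimal, ideal of ZFG, so z lies in
    soc(ZFG).  When soc(ZFG) is an ideal of FG, every product z g is central
    too; then z g h = z h g for all g and h, and z is constant on the cosets of
    P ([socle_ideal_der1_invariant]).  The proof exhibits central elements z of
    this kind whose being constant on P is a strong statement about G.

    That a class sum acts on z as a scalar is checked by counting modulo p.  Let
    z be constant on the cosets of a normal subgroup M with Z P' <= M <= P.  A
    class in P - M is acted on by P without fixed points and without changing
    the cosets of M, so its sum kills z; a class not centralizing M is treated
    in the same way with M acting.  Only the classes in C_G(M) - P remain
    ([der1_invariant]).  If no p'-element of G centralizes M there are none,
    and the sum of M itself is such an element z, which forces M = P
    ([normal_faithful_eq_der1]).  Two choices of M give the structure of G':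
    - M = P' C_P(P') gives P = C_P(P'), that is P' <= Z;
    - with K = C_H(Z), the M such that M / Z consists of the elements of order
      at most p of [V, K] gives that V is elementary abelian and V = [V, K].
    As K centralizes Z, the image of [P, K] in the abelian group P / P' meets
    Z / P' trivially by coprime action, and it covers V; so it is the
    complement T of part (i), see [center_complement_exists].

    For part (ii) let T be the direct product of minimal normal subgroups T_i.
    It is enough that H permutes transitively the tuples (t_i) of nontrivial
    t_i in T_i.  Fix such a tuple and consider the element
      sum over a in H of prod over i of (t_i^a - 1)
    of F[V], pulled back to FG along P -> V.  It is central and constant on the
    cosets of Z.  An element y of C_G(Z) - P acts nontrivially on V, hence
    without nontrivial fixed points on some T_i; then the sum of the class of y is
    T_i-periodic modulo Z and is killed by every factor t_i^a - 1.  So this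
    element is constant on P.  Its coefficient at the product of another tuple
    (t'_i) is the number of a in H sending (t_i) to (t'_i).  For t' = t this is
    the order of a subgroup of the p'-group H, which is nonzero in F, so it is
    nonzero for every t' ([components_transitive]).

    Transitivity of the abelian group H on tuples implies transitivity on the
    nontrivial elements of each T_i.  The action of H / C_H(T_i) there is
    regular, which gives the order |T_i| - 1; it is cyclic as a faithful
    irreducible abelian linear group; and the map of H to the product of the
    H / C_H(T_i) is onto because tuples can be moved independently. *)

Import GroupScope GRing.Theory.

Set Implicit Arguments.
Unset Strict Implicit.
Unset Printing Implicit Defensive.

(** * Coprime action and sums over orbits of p-groups *)

(** Coprime action lifts fixed points from Q / N to Q: so a group acting trivially
    on N and on Q / N acts trivially on Q. *)
Lemma coprime_cent_series (gT : finGroupType) (A N Q : {group gT}) :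
    A \subset 'N(N) -> N <| Q -> coprime #|Q| #|A| -> solvable Q ->
    A \subset 'C(N) -> [~: Q, A] \subset N ->
  A \subset 'C(Q).
Proof.
move=> nNA nsNQ coQA solQ cNA sQAN; have [sNQ nNQ] := andP nsNQ.
have sNC : N \subset 'C_Q(A) by rewrite subsetI sNQ centsC.
have nsNC : N <| 'C_Q(A) by rewrite (normalS sNC (subsetIl _ _)).
have eqC : 'C_Q(A) / N = Q / N.
  by rewrite coprime_quotient_cent // (setIidPl (quotient_cents2r sQAN)).
by rewrite centsC -(quotient_inj nsNC nsNQ eqC) subsetIr.
Qed.

(** All orbits have size divisible by p, so they contribute zero one by one. *)
Lemma sum_pgroup_fixfree (R : nzRingType) (p : nat) (gT : finGroupType)
    (Q : {group gT}) (C : {set gT}) (f : gT -> R) :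
    p \in [pchar R]%R -> p.-group Q -> Q \subset 'N(C) ->
    {in C, forall c, ~~ (Q \subset 'C[c])} ->
    {in C & Q, forall c u, f (c ^ u) = f c} ->
  (\sum_(c in C) f c = 0)%R.
Proof.
move=> chRp pQ nCQ ffix fJ; have actC : [acts Q, on C | 'J].
  by rewrite astabsJ.
rewrite (set_partition_big _ (orbit_partition actC)) /=.
apply: big1 => _ /imsetP[c Cc ->].
rewrite (eq_bigr (fun=> f c)) => [|_ /orbitP[u Qu <-]]; last exact: fJ.
rewrite sumr_const card_orbit -mulr_natr.
have /dvdnP[k ->] : p %| #|Q : 'C_Q[c | 'J]|; last first.
  by rewrite natrM (pcharf0 chRp) !mulr0.
have pri := pcharf_prime chRp; have: p.-nat #|Q : 'C_Q[c | 'J]|.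
  exact: pnat_dvd (dvdn_indexg _ _) pQ.
case/p_natP=> // -[|e] def_i; last by rewrite def_i expnS dvdn_mulr.
move/eqP: def_i; rewrite indexg_eq1 subsetI subxx /=.
by rewrite astab1J (negPf (ffix c Cc)).
Qed.

(** * Central elements with a scalar action of the class sums *)

Section GroupAlgebra.

Variables (F : fieldType) (gT : finGroupType) (G : {group gT}).
Implicit Type f : gT -> F.

Local Notation aG := (regular_repr F G).
Local Notation R_G := (group_ring F G).

Definition gring_elt f := (\sum_(x in G) f x *: aG x)%R.

Lemma gring_elt_inj f1 f2 :
  gring_elt f1 = gring_elt f2 -> {in G, f1 =1 f2}.
Proof.
have proj_f f x : x \in G -> gring_proj x (gring_elt f) = (f x)%:M%R.
  move=> Gx; rewrite linear_sum (bigD1 x) //= linearZ /= gring_projE // eqxx.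
  rewrite big1 ?addr0 => [|y /andP[Gy ne_yx]]; first by rewrite scalemx1.
  by rewrite linearZ /= gring_projE // eq_sym (negPf ne_yx) scaler0.
move=> eq_f x Gx; have /matrixP/(_ 0%R 0%R) := proj_f f2 x Gx.
by rewrite -eq_f proj_f // !mxE eqxx !mulr1n.
Qed.

Lemma gring_elt_mulG f c :
  c \in G -> (gring_elt f *m aG c)%R = gring_elt (fun x => f (x * c^-1)).
Proof.
move=> Gc; rewrite mulmx_suml [RHS](reindex_inj (mulIg c)) /=.
rewrite [RHS](eq_bigl (mem G)) => [|x]; last by rewrite /= groupMr.
by apply: eq_bigr => x Gx; rewrite -scalemxAl -repr_mxM // mulgK.
Qed.

Lemma gring_elt_mulgset f (C : {set gT}) : C \subset G ->
  (gring_elt f *m gset_mx F G C)%R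
    = gring_elt (fun x => \sum_(c in C) f (x * c^-1)%g)%R.
Proof.
move=> sCG; rewrite mulmx_sumr.
rewrite (eq_bigr (fun c => gring_elt (fun x => f (x * c^-1)))) => [|c Cc].
  by rewrite exchange_big; apply: eq_bigr => x Gx; rewrite scaler_suml.
by rewrite gring_elt_mulG ?(subsetP sCG).
Qed.

Lemma gring_elt_center f : {in G &, forall x g, f (x ^ g) = f x} ->
  (gring_elt f \in 'Z(R_G))%MS.
Proof.
move=> fJ; rewrite sub_capmx; apply/andP; split.
  by apply/envelop_mxP; exists f.
rewrite memmx_cent_envelop; apply/centgmxP=> g Gg.
rewrite gring_elt_mulG // mulmx_sumr (reindex_inj (mulgI g^-1)) /=.
rewrite (eq_bigl (mem G)) => [|x]; last by rewrite /= groupMl ?groupV.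
apply: eq_bigr => x Gx; rewrite -scalemxAr -repr_mxM ?groupM ?groupV // mulKVg.
by rewrite -(fJ (x * g^-1) g) ?groupM ?groupV // conjgE mulgKV.
Qed.

Lemma alg_socle_sub_center : (alg_socle 'Z(R_G) <= 'Z(R_G))%MS.
Proof.
have [[s min_s ->] _] := alg_socleP 'Z(R_G)%MS.
elim: s min_s => [|I s IHs] min_s; first by rewrite big_nil sub0mx.
rewrite big_cons addsmx_sub; case: (min_s I (mem_head _ _)) => /andP[-> _] _ _.
by apply: IHs => J sJ; apply: min_s; rewrite inE sJ orbT.
Qed.

(** The second hypothesis is the coefficientwise form of z C = |C| z, for z the
    element with coefficients f and C any class sum.  As the class sums span
    the center, the line through z is then an ideal of the center, and it is
    minimal for dimension reasons. *)
Lemma gring_elt_socle f :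
    {in G &, forall x g, f (x ^ g) = f x} ->
    {in G &, forall x y, \sum_(c in y ^: G) f (x * c^-1)%g = f x *+ #|y ^: G|}%R ->
  (gring_elt f \in alg_socle 'Z(R_G))%MS.
Proof.
move=> fJ fC; set z := gring_elt f; have Zz : (z \in 'Z(R_G))%MS.
  exact: gring_elt_center.
have [-> | nz_z] := eqVneq z 0%R; first by rewrite linear0 sub0mx.
have [_ maxS] := alg_socleP 'Z(R_G)%MS.
have Zmul A : (A \in 'Z(R_G))%MS -> exists a, (z *m A = a *: z)%R.
  rewrite -classg_base_center => /submxP[u defA].
  exists (\sum_k u 0 k * (#|enum_val k|)%:R)%R.
  apply: (can_inj mxvecK); rewrite -[A]mxvecK defA mulmx_sum_row.
  rewrite linear_sum mulmx_sumr scaler_suml; congr mxvec.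
  apply: eq_bigr => k _; rewrite linearZ /= rowK mxvecK -scalemxAr -scalerA.
  congr (_ *: _)%R; have [y Gy ->] := imsetP (enum_valP k).
  rewrite gring_elt_mulgset ?class_subG // scaler_sumr; apply: eq_bigr => x Gx.
  by rewrite scalerA fC // mulr_natl.
have sub_z (B : 'M_#|G|) : reflect (exists a, B = a *: z)%R (B \in <<mxvec z>>)%MS.
  rewrite genmxE; apply: (iffP sub_rVP) => [] [a defB]; exists a.
    by apply: (can_inj mxvecK); rewrite defB linearZ.
  by rewrite defB linearZ.
apply: (submx_trans _ (maxS <<mxvec z>>%MS _)); first by rewrite genmxE.
split; first 1 last.
- by rewrite -mxrank_eq0 genmxE mxrank_eq0 mxvec_eq0.
- move=> U _ nzU; rewrite !genmxE => sUz.
  have := mxrankS sUz; rewrite rank_rV mxvec_eq0 nz_z.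
  rewrite leq_eqVlt ltnS leqn0 mxrank_eq0 (negPf nzU) orbF => /eqP rU.
  by rewrite -(geq_leqif (mxrank_leqif_sup sUz)) rU rank_leq_row.
rewrite /alg_ideal genmxE Zz /=; apply/andP; split; apply/mulsmx_subP=> A1 A2 /=.
  move=> ZA /sub_z[a ->]; have [b zA] := Zmul _ ZA.
  apply/sub_z; exists (a * b)%R; rewrite -scalemxAr -scalerA -zA.
  congr (_ *: _)%R; move: ZA Zz; rewrite !sub_capmx => /andP[RA _] /andP[_].
  by move/cent_mxP=> ->.
move=> /sub_z[a ->] /Zmul[b zA]; apply/sub_z; exists (a * b)%R.
by rewrite -scalemxAl zA scalerA.
Qed.

(** In an ideal contained in the center every multiple z g is again central, so
    z g h = z h g; hence right multiplication by commutators fixes z. *)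
Lemma socle_ideal_der1_invariant f :
    alg_ideal R_G (alg_socle 'Z(R_G)%MS) ->
    {in G &, forall x g, f (x ^ g) = f x} ->
    {in G &, forall x y, \sum_(c in y ^: G) f (x * c^-1)%g = f x *+ #|y ^: G|}%R ->
  forall x d, x \in G -> d \in G^`(1) -> f (x * d) = f x.
Proof.
case/and3P=> _ _ idSR fJ fC; have idS A B := mulsmx_subP idSR A B.
have Sz := gring_elt_socle fJ fC; set z := gring_elt f in Sz.
have zZ g h : g \in G -> h \in G ->
    (z *m aG g *m aG h = aG h *m (z *m aG g))%R.
  move=> Gg Gh; have /(idS _ (aG g) Sz) : (aG g \in R_G)%MS.
    exact: envelop_mx_id.
  move/submx_trans/(_ alg_socle_sub_center); rewrite sub_capmx => /andP[_].
  by move/cent_mxP->; rewrite ?envelop_mx_id.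
have zcomm g h : g \in G -> h \in G -> (z *m aG (g * h)%g = z *m aG (h * g)%g)%R.
  move=> Gg Gh; rewrite !repr_mxM // !mulmxA zZ // mulmxA.
  by have := zZ _ _ (group1 G) Gh; rewrite repr_mx1 mulmx1 => ->.
pose S := [set d in G | (z *m aG d == z)%R].
have fixS : group_set S.
  apply/group_setP; split; first by rewrite inE group1 repr_mx1 mulmx1 /=.
  move=> d e /setIdP[Gd /eqP zd] /setIdP[Ge /eqP ze].
  by rewrite inE groupM // repr_mxM // mulmxA zd ze /=.
have sG'S : G^`(1) \subset Group fixS.
  rewrite gen_subG; apply/subsetP=> _ /imset2P[g h Gg Gh ->].
  (* Swap the two factors of g^-1 h^-1 in z g^-1 h^-1 g h. *)
  rewrite inE groupR //= commgEl conjgE mulgA repr_mxM ?groupM ?groupV //.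
  rewrite mulmxA zcomm ?groupV // -mulmxA -repr_mxM ?groupM ?groupV //.
  by rewrite mulgA mulgKV mulVg repr_mx1 mulmx1.
(* The coefficient of z d^-1 at x is the one of z at x d. *)
move=> x d Gx /groupVr/(subsetP sG'S)/setIdP[Gd /eqP].
by rewrite gring_elt_mulG // invgK => /gring_elt_inj->.
Qed.

End GroupAlgebra.
(** * Basic groups *)

Section BasicGroup.

Variables (F : fieldType) (p : nat) (gT : finGroupType) (G H : {group gT}).
Hypothesis charFp : p \in [pchar F]%R.
Hypothesis basicG : basic_group p G.
Hypothesis hallH : p^'.-Hall(G) H.
Hypothesis abelianH : abelian H.
Hypothesis defG : G^`(1) ><| H = G.

Local Notation P := (G^`(1))%G.

Lemma basic_der1_Sylow : p.-Sylow(G) P. Proof. by case/andP: basicG. Qed.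

Lemma basic_der1_pgroup : p.-group P. Proof. exact: pHall_pgroup basic_der1_Sylow. Qed.

Lemma basic_coprime_der1 (B : {group gT}) : B \subset H -> coprime #|P| #|B|.
Proof.
move=> sBH; apply: pnat_coprime basic_der1_pgroup _.
exact: pgroupS sBH (pHall_pgroup hallH).
Qed.

(** C_H(P) is normalized by P and by the abelian group H, so it is a normal
    p'-subgroup of G. *)
Lemma basic_cent_compl : 'C_H(P) = 1.
Proof.
have sHG := pHall_sub hallH; case/andP: basicG => _ /eqP O1.
apply/trivgP; rewrite -O1; apply: pcore_max.
  exact: pgroupS (subsetIl _ _) (pHall_pgroup hallH).
rewrite /normal subIset ?sHG //= -{1}(sdprodW defG) mulG_subG; apply/andP; split.
  by rewrite cents_norm // centsC subsetIr.
by rewrite cents_norm // centsC subIset // -abelianE abelianH.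
Qed.

(** A Hall p'-subgroup of G meets a normal subgroup in a Hall p'-subgroup. *)
Lemma basic_normal_sub (L : {group gT}) :
  L <| G -> H :&: L = 1 -> L \subset P.
Proof.
move=> nsLG tiHL; have sLG := normal_sub nsLG.
rewrite (sub_normal_Hall basic_der1_Sylow (der_normal 1 G) sLG).
have := Hall_setI_normal nsLG hallH.
by move/card_Hall => /=; rewrite tiHL cards1 => /esym/eqP; rewrite partG_eq1 pgroupNK.
Qed.

Lemma basic_cent_sub (N : {group gT}) :
  N <| G -> 'C_H(N) = 1 -> 'C_G(N) \subset P.
Proof.
move=> nsNG tiHN; apply: basic_normal_sub.
  by rewrite /normal subsetIl normsI ?normG ?norms_cent ?normal_norm.
by rewrite setIA (setIidPl (pHall_sub hallH)).
Qed.

Hypothesis socZ_ideal :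
  alg_ideal (group_ring F G) (alg_socle 'Z(group_ring F G)%MS).

(** The scalar action of the class sums, for a function constant on the cosets of
    M.  For classes outside M both sides vanish modulo p: the class of an
    element of P - M is permuted by P, and that of an element not centralizing
    M is permuted by M, in orbits of size divisible by p on which the function
    c |-> f (x c^-1) does not vary.  The size of a class not centralized by P is
    divisible by p as well, which settles the classes of the third hypothesis. *)
Lemma der1_invariant (M : {group gT}) (f : gT -> F) :
    M <| G -> 'Z(P) \subset M -> P^`(1) \subset M -> M \subset P ->
    {in G &, forall x g, f (x ^ g) = f x} ->
    {in G & M, forall x m, f (x * m) = f x} ->
    {in G & 'C_G(M) :\: P, forall x y, \sum_(c in y ^: G) f (x * c^-1)%g = 0}%R ->
  {in G & P, forall x d, f (x * d) = f x}.
Proof.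
move=> nsMG sZM sP'M sMP fJ fM fC x d Gx.
have nsPG : P <| G := der_normal 1 G; have [sPG nPG] := andP nsPG.
have cPP : 'C_G(P) \subset P := basic_cent_sub nsPG basic_cent_compl.
have [sMG nMG] := andP nsMG; have pP := basic_der1_pgroup.
apply: (socle_ideal_der1_invariant socZ_ideal fJ) => // {d Gx} {}x y Gx Gy.
have fixfree (Q : {group gT}) : Q <| G -> y \notin 'C(Q) ->
    {in y ^: G, forall c, ~~ (Q \subset 'C[c])}.
  move=> nsQG nCy c /imsetP[g Gg ->].
  by rewrite -cent_set1 centsC sub1set memJ_norm // (subsetP (norms_cent (normal_norm nsQG))).
have fixsum (Q : {group gT}) : Q <| G -> Q \subset P -> y \notin 'C(Q) ->
    {in y ^: G & Q, forall c u, [~ c, u] \in M} ->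
  (\sum_(c in y ^: G) f (x * c^-1)%g = f x *+ #|y ^: G|)%R.
  move=> nsQG sQP ncQ cQM.
  have sumQ := sum_pgroup_fixfree charFp (pgroupS sQP pP) _ (fixfree Q nsQG ncQ).
  have nyQ : Q \subset 'N(y ^: G).
    by rewrite (subset_trans (normal_sub nsQG)) // class_norm.
  rewrite sumQ // => [|c u Cc Qu]; last first.
    have Gc : c \in G by apply: subsetP Cc; rewrite class_sub_norm.
    have ->: x * (c ^ u)^-1 = x * c^-1 * [~ c, u]^-1 ^ c^-1.
      by rewrite conjg_mulR invMg conjgE invgK !mulgA mulgKV.
    apply: fM; first by rewrite groupM ?groupV.
    by rewrite memJ_norm ?groupV ?cQM // (subsetP nMG) ?groupV.
  by rewrite -sumr_const sumQ.
have [My | nMy] := boolP (y \in M).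
  rewrite -sumr_const; apply: eq_bigr => c Cc; apply: fM => //.
  by rewrite groupV; apply: subsetP Cc; rewrite class_sub_norm.
have [Py | nPy] := boolP (y \in P).
  apply: (fixsum P) => // [|c u Cc Pu].
    by apply: contra nMy => cPy; apply: (subsetP sZM); rewrite inE Py.
  apply: (subsetP sP'M); apply: mem_commg => //.
  by apply: subsetP Cc; rewrite class_sub_norm.
have [cMy | ncMy] := boolP (y \in 'C(M)); last first.
  apply: (fixsum M) => // c u Cc Mu.
  have Gc : c \in G by apply: subsetP Cc; rewrite class_sub_norm.
  by rewrite commgEr groupM // memJ_norm ?groupV // (subsetP nMG) ?groupV.
rewrite fC ?inE ?Gy ?nPy // -sumr_const.
rewrite (sum_pgroup_fixfree charFp pP _ (fixfree P nsPG _)) //.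
  by rewrite (subset_trans sPG) // class_norm.
by apply: contra nPy => cPy; apply: (subsetP cPP); rewrite inE Gy.
Qed.

(** The sum of the elements of N satisfies the previous lemma with M = N, since
    C_G(N) <= P; being constant on P, it is the sum of P. *)
Lemma normal_faithful_eq_der1 (N : {group gT}) :
    N <| G -> 'Z(P) \subset N -> P^`(1) \subset N -> N \subset P ->
  'C_H(N) = 1 -> N :=: P.
Proof.
move=> nsNG sZN sP'N sNP cHN; apply/eqP; rewrite eqEsubset sNP /=.
apply/subsetP=> d Pd.
pose f x : F := (x \in N)%:R%R.
have : f (1 * d) = f 1.
  apply: (der1_invariant nsNG) => // [x g Gx Gg | x m Gx Nm | x y Gx].
  - by rewrite /f memJ_norm // (subsetP (normal_norm nsNG)).
  - by rewrite /f groupMr.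
  by case/setDP=> /(subsetP (basic_cent_sub nsNG cHN)) ->.
rewrite /f mul1g group1; case: (d \in N) => // /eqP.
by rewrite eq_sym oner_eq0.
Qed.

(** * The center of the derived subgroup and its complement *)

(** Take N = P' C_P(P').  A p'-element h centralizing N satisfies
    [P, h] <= C_P(N) <= N by the three subgroups lemma, hence centralizes P.
    So P = P' C_P(P'), where the factor P' can be omitted since it lies in the
    Frattini subgroup. *)
Lemma basic_der2_center : P^`(1) \subset 'Z(P).
Proof.
pose N := (P^`(1) <*> 'C_P(P^`(1)))%G.
have nsPG : P <| G := der_normal 1 G; have [sPG nPG] := andP nsPG.
have chN : N \char P by rewrite charY ?subcent_char ?der_char ?char_refl.
have nsNG := char_normal_trans chN nsPG.
have sCN : 'C_P(P^`(1)) \subset N := joing_subr _ _.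
have cPN : 'C_P(N) \subset N.
  by apply: subset_trans sCN; rewrite setIS // centS // joing_subl.
have sHG := pHall_sub hallH.
have cHN : 'C_H(N) = 1.
  apply/trivgP; rewrite -basic_cent_compl subsetI subsetIl /=.
  apply: (@coprime_cent_series _ _ N); rewrite ?subsetIr //.
  - exact: subset_trans (subsetIl _ _) (subset_trans sHG (normal_norm nsNG)).
  - exact: char_normal.
  - exact: basic_coprime_der1 (subsetIl _ _).
  - exact: (pgroup_sol basic_der1_pgroup).
  - apply: subset_trans cPN; rewrite subsetI commg_subl; apply/andP; split.
      exact: subset_trans (subsetIl _ _) (subset_trans sHG nPG).
    have cNB : [~: N, 'C_H(N)] = 1 by apply/commG1P; rewrite centsC subsetIr.
    apply/commG1P; apply: three_subgroup; first by rewrite (commGC _ N) cNB comm1G.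
    apply/trivgP; rewrite -cNB commSg // commg_subl.
    exact: normal_norm (char_normal chN).
have defN : N :=: P.
  apply: normal_faithful_eq_der1 => //.
  - apply: subset_trans sCN; rewrite subsetI subsetIl /=.
    by rewrite (subset_trans (subsetIr _ _)) // centS // der_sub.
  - exact: joing_subl.
  - exact: char_sub.
have: 'C_P(P^`(1)) = P.
  rewrite -[LHS]genGid; apply: Phi_nongen; apply/eqP.
  rewrite eqEsubset join_subG Phi_sub subsetIl.
  by rewrite -{1}defN /= genS // setSU // (Phi_joing basic_der1_pgroup) joing_subl.
by move=> defP; rewrite subsetI der_sub centsC -{1}defP subsetIr.
Qed.

Local Notation K := 'C_H('Z(P))%G.
Local Notation R := [~: P, K]%G.

Lemma commg_compl_normal : R <| G.
Proof.
have nPG : G \subset 'N(P) := der_norm 1 G; have sHG := pHall_sub hallH.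
rewrite /normal (subset_trans _ (der_sub 1 G)) /=; last first.
  by rewrite commg_subl; exact: subset_trans (subsetIl _ _) (subset_trans sHG nPG).
rewrite -{1}(sdprodW defG) mulG_subG commg_norml normsR //.
  exact: subset_trans nPG.
by rewrite cents_norm // centsC subIset // -abelianE abelianH.
Qed.

(** Let N / Z be the subgroup of elements of order at most p of R / Z.  A
    subgroup B of H centralizing N lies in K, so [V, B] <= R / Z, and the
    elements of order p of [V, B] are fixed by B; by coprime action there are
    none, so B centralizes V and Z, hence P.  Thus N = P. *)
Lemma der1_center_quotient :
  p.-abelem (P / 'Z(P)) /\ P / 'Z(P) = R / 'Z(P).
Proof.
have nsPG : P <| G := der_normal 1 G; have [sPG nPG] := andP nsPG.
have nsZG : 'Z(P) <| G := char_normal_trans (center_char _) nsPG.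
have nsZP : 'Z(P) <| P := center_normal _.
have [sRG nRG] := andP commg_compl_normal.
have sHG := pHall_sub hallH; have pP := basic_der1_pgroup.
have abPZ : abelian (P / 'Z(P)) by rewrite sub_der1_abelian ?basic_der2_center.
have sRP : R \subset P.
  by rewrite commg_subl (subset_trans _ nPG) // (subset_trans (subsetIl _ _)).
have sRPZ : R / 'Z(P) \subset P / 'Z(P) by rewrite quotientS.
pose N := (coset 'Z(P) @*^-1 'Ohm_1(R / 'Z(P)))%G.
have defNZ : N / 'Z(P) = 'Ohm_1(R / 'Z(P)) by rewrite cosetpreK.
have sZN : 'Z(P) \subset N by rewrite sub_cosetpre.
have sNP : N \subset P.
  rewrite -(quotientGK nsZP) cosetpreSK; exact: subset_trans (Ohm_sub _ _) sRPZ.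
have nsNG : N <| G.
  rewrite -(quotientGK nsZG) cosetpre_normal.
  by rewrite (char_normal_trans (Ohm_char _ _)) ?quotient_normal ?commg_compl_normal.
have defN : N :=: P.
  apply: normal_faithful_eq_der1 => //; first exact: subset_trans basic_der2_center _.
  suffices cPB (B : {group gT}) :
      B \subset H -> B \subset 'C(N) -> B \subset 'C(P).
    apply/trivgP; rewrite -basic_cent_compl subsetI subsetIl.
    exact: cPB (subsetIl _ _) (subsetIr _ _).
  move=> sBH cNB; have cZB : B \subset 'C('Z(P)) := subset_trans cNB (centS sZN).
  have sBK : B \subset K by rewrite subsetI sBH.
  have nZB : B \subset 'N('Z(P)).
    exact: subset_trans sBH (subset_trans sHG (normal_norm nsZG)).
  have coPB := basic_coprime_der1 sBH.
  have nPB : B \subset 'N(P) := subset_trans sBH (subset_trans sHG nPG).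
  apply: (@coprime_cent_series _ B 'Z(P) P) => //.
  - exact: pgroup_sol pP.
  - have nZPB : [~: P, B] \subset 'N('Z(P)).
      by apply: subset_trans (normal_norm nsZP); rewrite commg_subl.
    have nZP := normal_norm nsZP; have nZK : K \subset 'N('Z(P)).
      exact: subset_trans (subsetIl _ _) (subset_trans sHG (normal_norm nsZG)).
    rewrite -quotient_sub1 // (quotientR nZP nZB) subG1 -Ohm1_eq1 -subG1.
    rewrite -(@coprime_abel_cent_TI _ (B / 'Z(P)) (P / 'Z(P))) //; first 1 last.
    - exact: quotient_norms.
    - exact: coprime_morph.
    rewrite subsetI Ohm_sub /=.
    have sOhm : 'Ohm_1([~: P / 'Z(P), B / 'Z(P)]) \subset 'Ohm_1(R / 'Z(P)).
      have sR : [~: P / 'Z(P), B / 'Z(P)] \subset [~: P / 'Z(P), K / 'Z(P)].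
        exact: commgS (quotientS _ sBK).
      by rewrite -(quotientR nZP nZK) in sR; apply: OhmS sR.
    apply: subset_trans sOhm _.
    by rewrite -defNZ quotient_cents // centsC.
have defPZ : P / 'Z(P) = 'Ohm_1(R / 'Z(P)) by rewrite -defNZ defN.
split.
  by rewrite defPZ Ohm1_abelem ?(abelianS sRPZ) ?(pgroupS sRPZ) ?quotient_pgroup.
by apply/eqP; rewrite eqEsubset sRPZ {1}defPZ Ohm_sub.
Qed.

Local Notation L := (G^`(2))%G.
Local Notation D := (G / L)%G.
Local Notation A := (P / L)%G.
Local Notation ZD := ('Z(P) / L)%G.
Local Notation HD := (H / L)%G.

Lemma der1_quotient_der2 : D^`(1) = A.
Proof. by rewrite -quotient_der // der_norm. Qed.

(** The complement is R / L.  It meets Z / L trivially because K centralizes the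
    latter and has no fixed points on [P / L, K], and p-th powers of its elements
    lie in that intersection. *)
Lemma center_complement_exists :
  exists T : {group coset_of L}, [/\ T <| D, p.-abelem T & T \x ZD = D^`(1)].
Proof.
have nPG : G \subset 'N(P) := der_norm 1 G; have sHG := pHall_sub hallH.
have sKH : K \subset H := subsetIl _ _; have sKG := subset_trans sKH sHG.
have sRP : R \subset P by rewrite commg_subl (subset_trans sKG).
have nLG : G \subset 'N(L) := der_norm 2 G.
have nLP := subset_trans (der_sub 1 G) nLG.
have nLK := subset_trans sKG nLG.
have [abPZ defPZ] := der1_center_quotient.
have tiRZ : (R / L) :&: ZD = 1.
  have nAK : K / L \subset 'N(A) by rewrite quotient_norms ?(subset_trans sKG).
  have coAK : coprime #|A| #|K / L| by rewrite coprime_morph ?basic_coprime_der1.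
  apply/trivgP; rewrite -(coprime_abel_cent_TI nAK coAK (der_abelian 1 G)).
  rewrite /= (quotientR nLP nLK) setIS // quotient_cents // centsC.
  exact: subsetIr.
have defA : (R / L) * ZD = A.
  rewrite -quotientMl ?(subset_trans sRP) //.
  have nZP : P \subset 'N('Z(P)) := normal_norm (center_normal P).
  have nZR := subset_trans sRP nZP.
  apply/eqP; rewrite eqEsubset quotientS /=; last by rewrite mul_subG ?center_sub.
  by rewrite quotientS // (normC nZR) -quotientSK // defPZ.
exists (R / L)%G; split.
- by rewrite quotient_normal ?commg_compl_normal.
- have sRA : R / L \subset A by rewrite quotientS.
  have pri := pcharf_prime charFp.
  apply/(abelemP pri); split; first exact: abelianS sRA (der_abelian 1 G).
  move=> _ /morphimP[x Nx Rx ->] /=; have Px := subsetP sRP x Rx.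
  have NZx := subsetP (normal_norm (center_normal P)) x Px.
  have Zxp : x ^+ p \in 'Z(P).
    apply: coset_idr; first exact: groupX.
    by rewrite morphX //; have [_ ->] := abelemP pri abPZ; rewrite ?mem_quotient.
  apply/set1P; rewrite -[[set 1]]tiRZ -(morphX (coset_morphism L)) //= inE.
  by apply/andP; split; apply: mem_quotient => //; apply: groupX.
rewrite der1_quotient_der2 dprodE //.
by rewrite (sub_abelian_cent2 (der_abelian 1 G)) ?quotientS // center_sub.
Qed.

(** Such elements act trivially on P / L, which is T times Z / L, and on L, which
    is contained in Z; so the p'-elements among them centralize P. *)
Lemma cent_center_complement (T : {group coset_of L}) y :
    T \x ZD = D^`(1) -> y \in 'C_G('Z(P)) -> coset L y \in 'C(T) -> y \in P.
Proof.
have nPG : G \subset 'N(P) := der_norm 1 G; have sHG := pHall_sub hallH.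
have nLG : G \subset 'N(L) := der_norm 2 G.
have nLP := subset_trans (der_sub 1 G) nLG.
have nsZG : 'Z(P) <| G := char_normal_trans (center_char _) (der_normal 1 G).
rewrite der1_quotient_der2 => defA /setIP[Gy cZy] cTy.
pose S := ('C_G('Z(P)) :&: coset L @*^-1 'C(A))%G.
have nsSG : S <| G.
  rewrite /normal subIset ?subsetIl //= normsI //.
    by rewrite normsI ?normG ?norms_cent ?normal_norm.
  by rewrite norm_quotient_pre // norms_cent // quotient_norms.
apply: (subsetP (basic_normal_sub nsSG _)); last first.
  apply/setIP; split; first exact/setIP.
  apply/morphpreP; split; first exact: (subsetP nLG).
  rewrite /= -(dprodWY defA) centY; apply/setIP; split=> //.
  by apply: (subsetP (quotient_cent _ _)); apply: mem_quotient.
apply/trivgP; rewrite -basic_cent_compl subsetI subsetIl /=.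
have sSH : H :&: S \subset H := subsetIl _ _; have sSG := subset_trans sSH sHG.
apply: (@coprime_cent_series _ _ L P) => //.
- exact: subset_trans nLG.
- exact: der_normalS.
- exact: basic_coprime_der1.
- exact: pgroup_sol basic_der1_pgroup.
- rewrite subIset // orbC (subset_trans (subsetIl _ _)) // subIset // orbC.
  by rewrite centS // basic_der2_center.
have nLS := subset_trans sSG nLG.
rewrite commGC -quotient_cents2 ?(subset_trans (der_sub 1 G)) //.
by rewrite sub_quotient_pre // (subset_trans (subsetIr _ _)) // subsetIr.
Qed.

(** * Transitivity on tuples of nontrivial elements *)

Section Components.

Variables (T : {group coset_of L}) (n : nat) (Ti : 'I_n -> {group coset_of L}).
Hypothesis defA : T \x ZD = D^`(1).
Hypothesis minTi : forall i, minnormal (Ti i) D.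
Hypothesis defT : \big[dprod/1]_(i < n) Ti i = T.

Lemma component_sub_der1 i : Ti i \subset A.
Proof.
rewrite -der1_quotient_der2 -(dprodWY defA) -(bigdprodWY defT).
by rewrite sub_gen // subsetU // sub_gen // (bigcup_max i).
Qed.

Lemma component_normal i : Ti i <| D.
Proof.
have [/andP[_ nTiD] _] := mingroupP (minTi i).
rewrite /normal nTiD andbT (subset_trans (component_sub_der1 i)) //.
by rewrite quotientS // der_sub.
Qed.

(** Membership in this complement of Ti i expresses that the i-th component is
    trivial, without choosing projections. *)
Definition cocomponent i := (<<\bigcup_(j | j != i) Ti j>> <*> ZD)%G.

Lemma dprod_cocomponent i : Ti i \x cocomponent i = A.
Proof.
have := defA; rewrite -defT (bigD1 i) //= -dprodA der1_quotient_der2 => defTi.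
have [[_ B _ defB] _ _ _] := dprodP defTi; rewrite defB in defTi.
have [[C _ defC _] _ _ _] := dprodP defB; rewrite defC in defB.
by rewrite /= (bigdprodWY defC) (dprodWY defB).
Qed.

Lemma component_sub_cocomponent i j : j != i -> Ti j \subset cocomponent i.
Proof.
by move=> neq_ji; rewrite sub_gen // subsetU // sub_gen // (bigcup_max j).
Qed.

Lemma center_sub_cocomponent i : ZD \subset cocomponent i.
Proof. exact: joing_subr. Qed.

Lemma cocomponent_norm i : D \subset 'N(cocomponent i).
Proof.
rewrite normsY ?norms_gen //; last first.
  by rewrite quotient_norms // gFnorm_trans // der_norm.
by apply: norms_bigcup; apply/bigcapsP=> j _; apply: normal_norm (component_normal j).
Qed.

(** A is abelian and contains D', so conjugate elements of D act alike on A. *)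
Lemma conj_class_der1 d e m : d \in D -> e \in d ^: D -> m \in A -> m ^ e = m ^ d.
Proof.
move=> Dd /imsetP[g Dg ->] Am; rewrite conjg_mulR conjgM.
have Amd : m ^ d \in A.
  by rewrite memJ_norm // (subsetP (quotient_norms _ (der_norm 1 G))).
rewrite [RHS]/(m ^ d) conjgE; apply: (canLR (mulKg _)).
have cAA : A \subset 'C(A) := der_abelian 1 G.
by apply: (centsP cAA) => //=; rewrite -der1_quotient_der2 mem_commg.
Qed.

(** C_(Ti i)(d) is normal in D, hence trivial by minimality; so the map
    m |-> m^-1 m^(d^-1) of Ti i to itself is injective, hence onto.  One m then
    serves all elements of the class of d, because they act alike on Ti i. *)
Lemma component_conj_onto i d tau :
    d \in D -> d \notin 'C(Ti i) -> tau \in Ti i ->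
  exists2 m, m \in Ti i & {in d ^: D, forall e, e ^ m = tau * e}.
Proof.
move=> Dd ncd Ttau; have sTiA := component_sub_der1 i.
have nTiD := normal_norm (component_normal i).
have cAA : A \subset 'C(A) := der_abelian 1 G.
have nAD : D \subset 'N(A) := quotient_norms _ (der_norm 1 G).
have tiC : 'C_(Ti i)[d] = 1.
  have [_ minT] := mingroupP (minTi i).
  have [//|ntC] := eqVneq 'C_(Ti i)[d] 1.
  have sTC : 'C_(Ti i)[d] = Ti i.
    apply: (minT 'C_(Ti i)[d]%G); rewrite ?subsetIl // ntC /=.
    apply/subsetP=> g Dg; rewrite inE; apply/subsetP=> _ /imsetP[m /setIP[Tm cdm] ->].
    have Tmg : m ^ g \in Ti i by rewrite memJ_norm // (subsetP nTiD).
    have dDd' : d ^ g^-1 \in d ^: D by rewrite memJ_class ?groupV.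
    have := conj_class_der1 Dd dDd' (subsetP sTiA m Tm).
    have {}cdm : m ^ d = m by apply/conjg_fixP/commgP/cent1P.
    rewrite cdm => /(congr1 (fun x => x ^ g)); rewrite -conjgM => mgd.
    apply/setIP; split=> //; apply/cent1P/commgP/conjg_fixP.
    by rewrite -[RHS]mgd -conjgM; congr (_ ^ _); rewrite conjgE invgK !mulgA mulgKV.
  by case/negP: ncd; rewrite -sub_cent1 -sTC subsetIr.
pose h m := m^-1 * m ^ d^-1.
have injh : {in Ti i &, injective h}.
  move=> m k Tm Tk eq_h; apply: (mulIg k^-1); rewrite mulgV; apply/set1gP.
  rewrite -tiC; apply/setIP; split; first by rewrite groupM ?groupV.
  have fix_mk : (m * k^-1) ^ d^-1 = m * k^-1.
    rewrite conjMg conjVg -[m ^ _](mulKVg m) -/(h m) eq_h.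
    by rewrite /h -mulgA mulgK.
  by apply/cent1P/commgP/conjg_fixP; rewrite -{1}fix_mk conjgKV.
have sh : h @: Ti i \subset Ti i.
  apply/subsetP=> _ /imsetP[m Tm ->]; rewrite groupM ?groupV //.
  by rewrite memJ_norm // groupV (subsetP nTiD).
have /eqP defh : h @: Ti i == Ti i by rewrite eqEcard sh (card_in_imset injh) leqnn.
have: tau \in h @: Ti i by rewrite defh.
case/imsetP=> m Tm def_tau; exists m => // e dDe.
have Am := subsetP sTiA m Tm.
have eV : e^-1 \in d^-1 ^: D by rewrite classVg memV_invg.
have := conj_class_der1 (groupVr Dd) eV Am => mE.
by rewrite def_tau /h -mE !conjgE invgK !mulgA mulgKV.
Qed.

Lemma cocomponent_sub_der1 i : cocomponent i \subset A.
Proof. by have /dprodP[_ <- _ _] := dprod_cocomponent i; apply: mulG_subr. Qed.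

Lemma mem_prod_cocomponent (s : 'I_n -> coset_of L) i x :
    (forall j, s j \in Ti j) -> x \in Ti i ->
  (\prod_j s j * x^-1 \in cocomponent i) = (s i == x).
Proof.
move=> Ts Tx; have nMD := cocomponent_norm i.
have nMT j : Ti j \subset 'N(cocomponent i).
  exact: subset_trans (normal_sub (component_normal j)) nMD.
have Ns j : s j \in 'N(cocomponent i) := subsetP (nMT j) _ (Ts j).
have Nx := subsetP (nMT i) _ Tx.
have modM : coset (cocomponent i) (\prod_j s j) = coset (cocomponent i) (s i).
  rewrite -[coset _ _]/(coset_morphism _ _) morph_prod //.
  apply: big_only1 => // j neq_ji _.
  by apply: coset_id; apply: subsetP (Ts j); apply: component_sub_cocomponent.
have Np : \prod_j s j \in 'N(cocomponent i) by apply: group_prod.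
have [_ _ _ tiTM] := dprodP (dprod_cocomponent i).
apply/idP/eqP=> [|<-].
  rewrite -mem_rcoset => /rcoset_kercosetP-/(_ Np Nx).
  rewrite modM => /(rcoset_kercosetP (Ns i) Nx); rewrite mem_rcoset => Msx.
  apply: (mulIg x^-1); rewrite mulgV; apply/set1gP; rewrite -tiTM inE Msx andbT.
  by rewrite groupM ?groupV.
by rewrite -mem_rcoset; apply/rcoset_kercosetP; rewrite // modM.
Qed.

Section TransitiveAction.

Variable t : 'I_n -> coset_of L.
Hypothesis Tt : forall i, t i \in (Ti i)^#.

(** Coefficient functions on A: this one is t_i^a - 1, seen modulo the cocomponent
    of Ti i. *)
Definition comp_diff i a v : F :=
  (((v * (t i ^ a)^-1)%g \in cocomponent i)%:R - (v \in cocomponent i)%:R)%R.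

Definition comp_prod a v := (\prod_i comp_diff i a v)%R.

(** The element sum_a prod_i (t_i^a - 1), extended by zero to D. *)
Definition orbit_fun v := (if v \in A then \sum_(a in HD) comp_prod a v else 0)%R.

Let nAD : D \subset 'N(A) := quotient_norms _ (der_norm 1 G).
Let cAA : A \subset 'C(A) := der_abelian 1 G.
Let sAD : A \subset D := quotientS _ (der_sub 1 G).
Let sHDD : HD \subset D := quotientS _ (pHall_sub hallH).

Lemma component_conj_mem i a : a \in D -> t i ^ a \in Ti i.
Proof.
move=> Da; have /setD1P[_ Tti] := Tt i.
by rewrite memJ_norm // (subsetP (normal_norm (component_normal i))).
Qed.

Lemma comp_diff_mulr i a v m :
  a \in D -> v \in A -> m \in cocomponent i -> comp_diff i a (v * m) = comp_diff i a v.
Proof.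
move=> Da Av Mm; have Am := subsetP (cocomponent_sub_der1 i) m Mm.
have Ata := subsetP (component_sub_der1 i) _ (component_conj_mem i Da).
rewrite /comp_diff (groupMr v Mm) -mulgA (centsP cAA m Am) ?groupV // mulgA.
by rewrite (groupMr _ Mm).
Qed.

Lemma orbit_fun_mulr v m : m \in ZD -> orbit_fun (v * m) = orbit_fun v.
Proof.
move=> Zm; have Am : m \in A by apply: subsetP Zm; rewrite quotientS ?center_sub.
rewrite /orbit_fun groupMr //; case: ifP => // Av; apply: eq_bigr => a HDa.
apply: eq_bigr => i _; rewrite comp_diff_mulr ?(subsetP sHDD) //.
exact: (subsetP (center_sub_cocomponent i)).
Qed.

Lemma comp_diffJ i a v e : e \in D -> comp_diff i (a * e) (v ^ e) = comp_diff i a v.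
Proof.
move=> De; have Ne := subsetP (cocomponent_norm i) e De.
by rewrite /comp_diff conjgM -conjVg -conjMg !memJ_norm.
Qed.

(** D is the product of A, which acts trivially on A, and of HD, which permutes
    the terms of the sum. *)
Lemma orbit_funJ v d : d \in D -> orbit_fun (v ^ d) = orbit_fun v.
Proof.
move=> Dd; have: d \in A * HD.
  by rewrite -quotientMl ?(subset_trans (der_sub 1 G) (der_norm 2 G)) // (sdprodW defG).
case/mulsgP=> b e Ab HDe ->; have De := subsetP sHDD e HDe.
rewrite /orbit_fun memJ_norm; last first.
  by rewrite groupM ?(subsetP nAD) // (subsetP sAD).
case: ifP => // Av; rewrite conjgM.
have ->: v ^ b = v by apply/conjg_fixP/commgP/(centsP cAA).
rewrite (reindex_inj (mulIg e)) /=; apply: eq_big => [a | a _].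
  by rewrite groupMr.
by apply: eq_bigr => i _; rewrite comp_diffJ.
Qed.

(** As no component of the argument is trivial, the terms -1 of the factors do
    not contribute. *)
Lemma orbit_fun_prod (s : 'I_n -> coset_of L) :
    (forall i, s i \in (Ti i)^#) ->
  orbit_fun (\prod_i s i) = #|[set a in HD | [forall i, s i == (t i ^ a)%g]]|%:R%R.
Proof.
move=> Ts; have TTs i : s i \in Ti i by case/setD1P: (Ts i).
rewrite /orbit_fun group_prod => [|i _]; last exact: (subsetP (component_sub_der1 i)).
rewrite cardsE -sum1_card natr_sum big_mkcondr /=; apply: eq_bigr => a HDa.
have Da := subsetP sHDD a HDa.
have deltaE i : comp_diff i a (\prod_j s j) = (s i == (t i ^ a)%g)%:R%R.
  rewrite /comp_diff mem_prod_cocomponent ?component_conj_mem //.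
  have := mem_prod_cocomponent TTs (group1 (Ti i)); rewrite invg1 mulg1 => ->.
  by have /setD1P[/negPf-> _] := Ts i; rewrite subr0.
rewrite /comp_prod (eq_bigr _ (fun i _ => deltaE i)).
case: forallP => [eq_s | neq_s].
  by rewrite big1 // => i _; rewrite eq_s.
have [i neq_i] : exists i, s i != t i ^ a.
  by apply/existsP; rewrite -negb_forall; apply/forallP.
by rewrite (bigD1 i) //= (negPf neq_i) mul0r.
Qed.

(** The product of the factors other than the i-th one, placed where the i-th
    component is trivial. *)
Definition comp_prod_base i a v : F :=
  ((v \in cocomponent i)%:R * \prod_(j | j != i) comp_diff j a v)%R.

Lemma comp_prod_difference i a v : a \in D -> v \in A ->
  comp_prod a v = (comp_prod_base i a (v * (t i ^ a)^-1)%g - comp_prod_base i a v)%R.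
Proof.
move=> Da Av; rewrite /comp_prod (bigD1 i) //= /comp_prod_base.
rewrite -[comp_diff i a v]/(_ - _)%R mulrBl.
congr (_ * _ - _)%R; apply: eq_bigr => j neq_ji; rewrite comp_diff_mulr //.
apply: subsetP (groupVr (component_conj_mem i Da)).
by apply: component_sub_cocomponent; rewrite eq_sym.
Qed.

(** Each summand is a difference g (v t^-1) - g (v) with t = t_i^a.  Conjugation by
    a suitable element of Ti i multiplies all members of the class by t modulo L,
    so the two resulting sums over the class agree. *)
Lemma sum_orbit_fun_class y i x : y \in G -> coset L y \notin 'C(Ti i) -> x \in G ->
  (\sum_(c in y ^: G) orbit_fun (coset L (x * c^-1)%g) = 0)%R.
Proof.
move=> Gy ncy Gx; have nLG : G \subset 'N(L) := der_norm 2 G.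
pose psi a v := (if v \in A then comp_prod a v else 0)%R.
have psiE v : (orbit_fun v = \sum_(a in HD) psi a v)%R.
  by rewrite /orbit_fun /psi; case: ifP => // _; rewrite big1.
under eq_bigr => c _ do rewrite psiE.
rewrite exchange_big big1 //= => a HDa; have Da := subsetP sHDD a HDa.
have Dy : coset L y \in D by apply: mem_quotient.
have Ttau := component_conj_mem i Da; set tau := t i ^ a in Ttau.
have Atau : tau \in A := subsetP (component_sub_der1 i) _ Ttau.
have [m Tm tau_m] := component_conj_onto Dy ncy Ttau.
have /morphimP[u _ Pu def_m] := subsetP (component_sub_der1 i) m Tm.
have Gu : u \in G := subsetP (der_sub 1 G) u Pu.
pose g v := (if v \in A then comp_prod_base i a v else 0)%R.
have psi_g v : (psi a v = g (v * tau^-1)%g - g v)%R.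
  rewrite /psi /g groupMr ?groupV //; case: ifP => Av; last by rewrite subr0.
  exact: comp_prod_difference.
under eq_bigr => c _ do rewrite psi_g.
rewrite sumrB; apply/eqP; rewrite subr_eq0; apply/eqP.
rewrite [RHS](reindex_acts 'J _ Gu) ?astabsJ ?class_norm //=.
apply: eq_bigr => c yGc; have Gc : c \in G by apply: subsetP yGc; rewrite class_sub_norm.
have N z : z \in G -> z \in 'N(L) by apply: subsetP.
congr g; rewrite !morphM ?groupV ?N ?groupJ // !morphV ?N ?groupJ //= morphJ ?N //=.
rewrite -def_m tau_m; first by rewrite [(tau * _)^-1]invMg mulgA.
by case/imsetP: yGc => z Gz ->; rewrite morphJ ?N // memJ_class // mem_quotient.
Qed.

End TransitiveAction.

(** Evaluate the function attached to t, which is constant on P, at lifts of the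
    products of t and of t'. *)
Lemma components_transitive (t' t : 'I_n -> coset_of L) :
    (forall i, t' i \in (Ti i)^#) -> (forall i, t i \in (Ti i)^#) ->
  exists2 a, a \in HD & forall i, t' i = t i ^ a.
Proof.
move=> Tt' Tt; pose f x := orbit_fun t (coset L x).
have nLG : G \subset 'N(L) := der_norm 2 G.
have sPG := der_sub 1 G.
have nsZG : 'Z(P) <| G := char_normal_trans (center_char _) (der_normal 1 G).
have fP : {in G & P, forall x d, f (x * d) = f x}.
  apply: (der1_invariant nsZG) => //.
  - exact: basic_der2_center.
  - exact: center_sub.
  - move=> x g Gx Gg; rewrite /f morphJ ?(subsetP nLG) //=.
    by rewrite orbit_funJ // mem_quotient.
  - move=> x z Gx Zz.
    have Gz := subsetP (normal_sub nsZG) z Zz.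
    rewrite /f morphM ?(subsetP nLG) //= orbit_fun_mulr //; exact: mem_quotient.
  move=> x y Gx /setDP[CGy nPy].
  have [i ncy] : exists i, coset L y \notin 'C(Ti i).
    apply/existsP; apply: contraR nPy; rewrite negb_exists => /forallP cTy.
    apply: (cent_center_complement defA CGy).
    rewrite -sub_cent1 -(bigdprodWY defT) gen_subG; apply/bigcupsP=> i _.
    by rewrite sub_cent1; have := cTy i; rewrite negbK.
  by apply: sum_orbit_fun_class ncy _ => //; case/setIP: CGy.
have lift (s : 'I_n -> coset_of L) : (forall i, s i \in (Ti i)^#) ->
    exists2 x, x \in P & coset L x = \prod_i s i.
  move=> Ts; have: \prod_i s i \in A.
    apply: group_prod => i _; apply: (subsetP (component_sub_der1 i)).
    by case/setD1P: (Ts i).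
  by case/morphimP=> x _ Px ->; exists x.
have [w Pw def_w] := lift t Tt; have [w' Pw' def_w'] := lift t' Tt'.
have: f w' = f w.
  by rewrite -[w'](mulKVg w) fP ?groupM ?groupV // (subsetP sPG).
rewrite /f def_w def_w' !orbit_fun_prod // => eq_f.
have [a | ] := pickP [pred a in HD | [forall i, t' i == t i ^ a]].
  by case/andP=> HDa /forallP eq_t'; exists a => // i; apply/eqP.
move=> no_a; move: eq_f; rewrite (_ : [set a in HD | _] = set0); last first.
  by apply/setP=> a; rewrite !inE; apply: no_a.
rewrite cards0 => /esym/eqP; rewrite -(dvdn_pcharf charFp).
(* The value at t is the order of the stabilizer of t, a p'-group. *)
have ->: [set a in HD | [forall i, t i == t i ^ a]] = 'C_HD([set t i | i : 'I_n]).
  apply/setP=> a; rewrite !inE; congr (_ && _); apply/forallP/centP=> [cta | cta i].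
    by move=> _ /imsetP[i _ ->]; apply/commute_sym/commgP/conjg_fixP/esym/eqP.
  rewrite eq_sym; apply/eqP/conjg_fixP/commgP/commute_sym/cta.
  exact: imset_f.
have: p^'.-group 'C_HD([set t i | i : 'I_n]).
  exact: pgroupS (subsetIl _ _) (quotient_pgroup L (pHall_pgroup hallH)).
by rewrite /pgroup p'natE ?(pcharf_prime charFp) // => /negPf->.
Qed.

End Components.

End BasicGroup.

(** * Decomposition into minimal normal subgroups *)

(** A minimal normal subgroup N <= T has a complement in T, hence in A, hence in D
    by Gaschuetz; the intersection of the latter with T is a complement of N in
    T which is normal in D, as T is abelian. *)
Lemma minnormal_decomposition (p : nat) (gT : finGroupType)
    (D T Z A : {group gT}) :
    p.-abelem T -> T <| D -> T \x Z = A -> A <| D -> abelian A ->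
    coprime #|A| #|D : A| ->
  exists n (Ti : 'I_n -> {group gT}),
    (forall i, minnormal (Ti i) D) /\ \big[dprod/1]_(i < n) Ti i = T.
Proof.
have [m] := ubnP #|T|; elim: m T Z => // m IHm T Z; rewrite ltnS => leTm.
move=> abT nsTD defA nsAD abA coAD; have [sTD nTD] := andP nsTD.
have [T1 | ntT] := eqsVneq T 1.
  exists 0, (fun=> 1%G); split; first by case.
  by rewrite big_ord0 T1.
have [N minN sNT] := minnormal_exists ntT nTD.
have [/andP[ntN nND] _] := mingroupP minN.
have nsND : N <| D by rewrite /normal (subset_trans sNT).
have sTA : T \subset A by have /dprodP[_ <- _ _] := defA; apply: mulG_subl.
have [K defT] := abelem_split_dprod abT sNT.
have splA : [splits A, over N].
  have := defA; rewrite -{1}defT -dprodA => defA'.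
  have [[_ B _ defB] defNB _ tiNB] := dprodP defA'; rewrite defB in defNB tiNB.
  by apply/splitsP; exists B; apply/complP.
have coN : coprime #|N| #|D : A| := coprime_dvdl (cardSg (subset_trans sNT sTA)) coAD.
rewrite -(Gaschutz_split nsND (subset_trans sNT sTA) (normal_sub nsAD) _ coN) in splA;
  last exact: abelianS (subset_trans sNT sTA) abA.
have [B /complP[tiNB defD]] := splitsP splA.
have abTT := abelem_abelian abT.
pose C := (T :&: B)%G.
have defTNC : N \x C = T.
  rewrite dprodE; first 1 last.
  - by rewrite (centSS _ sNT abTT) ?subsetIl.
  - by rewrite /C /= setICA tiNB (setIidPr _) ?sub1G.
  by rewrite /C /= setIC group_modl // defD (setIidPr sTD).
have nsCD : C <| D.
  rewrite /normal subIset ?sTD //= -{1}defD mulG_subG; apply/andP; split.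
    by rewrite cents_norm // (centSS sNT _ abTT) ?subsetIl.
  have sBD : B \subset D by rewrite -defD mulG_subr.
  by rewrite normsI ?normG // (subset_trans sBD).
have [|||n [Ti [minTi defC]]] := IHm C (N <*> Z)%G _ _ nsCD _ nsAD abA coAD.
- rewrite (leq_trans _ leTm) // -(dprod_card defTNC) ltn_Pmull ?cardG_gt1 //.
- exact: abelemS (subsetIl _ _) abT.
- have := defA; rewrite -defTNC (dprodC N) -dprodA => defA'.
  by have [[_ E _ defE] _ _ _] := dprodP defA'; rewrite /= (dprodWY defE) -defE.
exists n.+1, (fun i => if unlift ord0 i is Some j then Ti j else N); split.
  by move=> i; case: unliftP.
rewrite big_ord_recl unlift_none -defTNC -defC; congr (_ \x _).
by apply: eq_bigr => i _; rewrite liftK.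
Qed.

(** * Abelian groups acting transitively on nontrivial elements *)

Section AbelianTransitive.

Variables (gT : finGroupType) (X E : {group gT}).
Hypothesis abX : abelian X.
Hypothesis nEX : X \subset 'N(E).
Hypothesis transX : {in E^# &, forall s t, exists2 a, a \in X & s = t ^ a}.

(** In a transitive abelian group all point stabilizers coincide. *)
Lemma abelian_transitive_cent1 t : t \in E^# -> 'C_X[t] = 'C_X(E).
Proof.
move=> E't; have /setD1P[_ Et] := E't; apply/eqP; rewrite eqEsubset.
apply/andP; split; last by rewrite setIS // -cent_set1 centS // sub1set.
rewrite subsetI subsetIl centsC; apply/subsetP=> s Es.
have [-> | nts] := eqVneq s 1; first exact: group1.
have [|b Xb ->] := transX (x := s) _ E't; first exact/setD1P.
apply/centP=> a /setIP[Xa /cent1P cta]; apply/commgP/conjg_fixP.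
rewrite -conjgM -(centsP abX a Xa b Xb) conjgM; congr (_ ^ _).
exact/conjg_fixP/commgP/commute_sym.
Qed.

Lemma card_abelian_transitive : E :!=: 1 -> #|X / 'C_X(E)| = #|E|.-1.
Proof.
case/trivgPn=> t Et nt_t; have E't : t \in E^# by apply/setD1P.
have nsCX : 'C_X(E) <| X by rewrite -sub_abelian_normal ?subsetIl.
rewrite card_quotient ?normal_norm //= -(abelian_transitive_cent1 E't).
have ->: 'C_X[t] = 'C_X[t | 'J] by rewrite astab1J.
rewrite -card_orbit (_ : orbit _ _ _ = E^#); first by rewrite (cardsD1 1 E) group1.
apply/setP=> s; apply/orbitP/idP=> [[a Xa <-] | Es].
  by apply/setD1P; rewrite conjg_eq1 memJ_norm // (subsetP nEX).
by have [a Xa ->] := transX Es E't; exists a.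
Qed.

(** Transitivity makes E an irreducible module, faithful for the quotient. *)
Lemma cyclic_abelian_transitive p : p.-abelem E -> E :!=: 1 -> cyclic (X / 'C_X(E)).
Proof.
move=> abE ntE; pose rG := abelem_repr abE ntE nEX.
have irrG : mx_irreducible rG.
  apply/abelem_mx_irrP/mingroupP; split; first by rewrite ntE.
  move=> B /andP[/trivgPn[t Bt nt_t] nBX] sBE; apply/eqP; rewrite eqEsubset sBE.
  apply/subsetP=> s Es; have [-> // | nts] := eqVneq s 1.
  have [||a Xa ->] := transX (x := s) (y := t); try by apply/setD1P; rewrite // (subsetP sBE).
  by rewrite memJ_norm // (subsetP nBX).
have <- : rker rG = 'C_X(E) by apply: rker_abelem.
apply: mx_faithful_irr_abelian_cyclic (kquo_mx_faithful rG) _ _.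
  exact/quo_mx_irr.
exact: quotient_abelian.
Qed.

End AbelianTransitive.

Section TupleTransitive.

Variables (gT : finGroupType) (X T : {group gT}) (n : nat).
Variable Ti : 'I_n -> {group gT}.
Hypothesis abX : abelian X.
Hypothesis nTX : forall i, X \subset 'N(Ti i).
Hypothesis ntT : forall i, Ti i :!=: 1.
Hypothesis defT : \big[dprod/1]_(i < n) Ti i = T.
Hypothesis transX : forall s t : 'I_n -> gT,
    (forall i, s i \in (Ti i)^#) -> (forall i, t i \in (Ti i)^#) ->
  exists2 a, a \in X & forall i, s i = t i ^ a.

Let Wi i : {w | w \in (Ti i)^#}.
Proof. by case/trivgPn/sig2W: (ntT i) => w Tw ntw; exists w; apply/setD1P. Qed.
Let w i := sval (Wi i).
Let Tw i : w i \in (Ti i)^# := svalP (Wi i).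

Lemma tuple_transitive_component i :
  {in (Ti i)^# &, forall s t, exists2 a, a \in X & s = t ^ a}.
Proof.
move=> s t Ts Tt; pose ext x j := if j == i then x else w j.
have Text x : x \in (Ti i)^# -> forall j, ext x j \in (Ti j)^#.
  by move=> Tx j; rewrite /ext; case: eqP => [-> |].
have [a Xa eq_st] := transX (Text s Ts) (Text t Tt).
by exists a => //; have := eq_st i; rewrite /ext eqxx.
Qed.

Definition coset_tuple x :=
  finfun (fun i => coset 'C_X(Ti i) x) : {dffun forall i, coset_of 'C_X(Ti i)}.

Let nCX i : X \subset 'N('C_X(Ti i)).
Proof. by rewrite normsI ?normG ?norms_cent. Qed.

Lemma coset_tupleM : {in X &, {morph coset_tuple : x y / x * y}}.
Proof.
move=> x y Xx Xy; apply/ffunP=> i.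
by rewrite !ffunE morphM // (subsetP (nCX i)).
Qed.

Canonical coset_tuple_morphism := Morphism coset_tupleM.

(** A tuple of cosets of elements b_i is the image of any element of X sending
    (w_i) to (w_i^b_i), because the stabilizer of w_i is C_X(Ti i). *)
Lemma isog_tuple_transitive :
  X / 'C_X(T) \isog setXn (fun i => X / 'C_X(Ti i)).
Proof.
have <-: 'ker coset_tuple = 'C_X(T).
  rewrite -(bigdprodWY defT) cent_gen; apply/setP=> x.
  rewrite !inE; case Xx: (x \in X) => //=; apply/eqP/idP=> [x1 | cTx].
    apply/centP=> y /bigcupP[i _ Ty]; have /ffunP/(_ i) := x1; rewrite !ffunE.
    move/(coset_idr (subsetP (nCX i) x Xx))/setIP=> [_ /centP]; exact.
  apply/ffunP=> i; rewrite !ffunE; apply: coset_id; rewrite inE Xx.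
  by apply: subsetP cTx; rewrite centS // (bigcup_max i).
have <-: coset_tuple @* X = setXn (fun i => X / 'C_X(Ti i)).
  apply/setP=> y; apply/morphimP/setXnP=> [[x _ Xx ->] i | Xy].
    by rewrite ffunE mem_quotient.
  have /fin_all_exists2[b Xb def_y] i : exists2 b, b \in X & y i = coset 'C_X(Ti i) b.
    by case/morphimP: (Xy i) => b _ Xb ->; exists b.
  have [||a Xa def_a] := transX (s := fun i => w i ^ b i) (t := w) => [i|//|].
    have /setD1P[ntw Twi] := Tw i.
    by apply/setD1P; rewrite conjg_eq1 memJ_norm // (subsetP (nTX i)).
  exists a => //; apply/ffunP=> i; rewrite ffunE def_y.
  have Na := subsetP (nCX i) a Xa; have Nb := subsetP (nCX i) _ (Xb i).
  apply/rcoset_kercosetP=> //; rewrite mem_rcoset /=.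
  rewrite -(abelian_transitive_cent1 abX (tuple_transitive_component (i := i)) (Tw i)).
  rewrite inE groupM ?groupV //=; apply/cent1P/commute_sym/commgP/conjg_fixP.
  by rewrite conjgM def_a conjgK.
exact: first_isog.
Qed.

End TupleTransitive.

Theorem theorem1 (F : fieldType) (p : nat) (gT : finGroupType)
    (G H : {group gT})
    (charFp : p \in [pchar F]%R)
    (basicG : basic_group p G)
    (socZ_ideal :
       alg_ideal (group_ring F G) (alg_socle 'Z(group_ring F G)%MS))
    (hallH : p^'.-Hall(G) H)
    (abelianH : abelian H)
    (defG : G^`(1) ><| H = G) :
  let D := (G / G^`(2))%G in
  let ZD := ('Z(G^`(1)) / G^`(2))%G in
  let HD := (H / G^`(2))%G in
  exists T : {group coset_of G^`(2)},
    [/\ T <| D, p.-abelem T & T \x ZD = D^`(1)]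
    /\ (exists n (Ti : 'I_n -> {group coset_of G^`(2)}),
          (forall i, minnormal (Ti i) D) /\ \big[dprod/1]_(i < n) Ti i = T)
    /\ (forall n (Ti : 'I_n -> {group coset_of G^`(2)}),
          (forall i, minnormal (Ti i) D) ->
          \big[dprod/1]_(i < n) Ti i = T ->
          HD / 'C_HD(T) \isog setXn (fun i => HD / 'C_HD(Ti i))
          /\ (forall i, cyclic (HD / 'C_HD(Ti i))
                        /\ #|HD / 'C_HD(Ti i)| = #|Ti i|.-1)).
Proof.
move=> D ZD HD.
have [T [nsTD abT defA]] :=
  center_complement_exists charFp basicG hallH abelianH defG socZ_ideal.
have sPG := der_sub 1 G; have sHG := pHall_sub hallH.
have nLG : G \subset 'N(G^`(2)) := der_norm 2 G.
have defD1 : D^`(1) = G^`(1) / G^`(2) := der1_quotient_der2 G.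
exists T; split=> //; split=> [|n Ti minTi defT].
  apply: (@minnormal_decomposition p _ _ _ ZD (G^`(1) / G^`(2)) abT nsTD).
  - exact: etrans defA defD1.
  - by rewrite quotient_normal ?der_normal.
  - exact: der_abelian.
  have sylA : p.-Sylow(D) (G^`(1) / G^`(2)).
    apply: quotient_pHall (basic_der1_Sylow basicG).
    exact: subset_trans sPG nLG.
  by have /andP[_] := pHall_Hall sylA.
have sTT i : Ti i \subset T.
  by rewrite -(bigdprodWY defT) sub_gen // (bigcup_max i).
have abTi i : p.-abelem (Ti i) := abelemS (sTT i) abT.
have ntT i : Ti i :!=: 1 by have [/andP[]] := mingroupP (minTi i).
have nTX i : HD \subset 'N(Ti i).
  have [/andP[_ nTD] _] := mingroupP (minTi i).
  exact: subset_trans (quotientS _ sHG) nTD.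
have abHD : abelian HD by apply: quotient_abelian.
have transHD := @components_transitive F p gT G H charFp basicG hallH abelianH defG
  socZ_ideal T n Ti defA minTi defT.
split; first exact: (isog_tuple_transitive abHD nTX ntT defT transHD).
move=> i; have transi := tuple_transitive_component ntT transHD (i := i).
split; first exact: cyclic_abelian_transitive (abTi i) (ntT i).
exact: card_abelian_transitive.
Qed.
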